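(* Let $E$ be a separable Hilbert space. Suppose $x,y\in H^2(\mathbb{D},E)$. Then $x\,\dot\wedge\, y\in H^1(\mathbb{D},\wedge^2E)$.
   Context: $\mathbb{D}$ is the open unit disc. Hilbert spaces are complex. Wedge products: for a Hilbert space $E$, $\otimes_H^2E$ is the completion of the algebraic tensor square of $E$ for the norm induced by the inner product $\langle x_1\otimes x_2,\,y_1\otimes y_2\rangle=2\langle x_1,y_1\rangle_E\langle x_2,y_2\rangle_E$ (note the factor $2=2!$). $\wedge^2E$ is the closed subspace of antisymmetric tensors (those changing sign under the unitary flip $x\otimes y\mapsto y\otimes x$), with the inherited inner product, and $x\wedge y$ is the orthogonal projection of $x\otimes y$ onto $\wedge^2E$. Consequently $\langle x_1\wedge x_2,\,y_1\wedge y_2\rangle_{\wedge^2E}=\det(\langle x_i,y_k\rangle_E)_{i,k=1}^2$. The pointwise wedge product is $(x\,\dot\wedge\, y)(z)=x(z)\wedge y(z)$ for $z\in\mathbb{D}$. For $1\le p<\infty$, $H^p(\mathbb{D},E)$ is the space of analytic $f:\mathbb{D}\to E$ with $\|f\|_p=\sup_{0<r<1}\left(\frac1{2\pi}\int_0^{2\pi}\|f(re^{i\theta})\|_E^p\,d\theta\right)^{1/p}<\infty$. *)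

(* Defs.v *)
From HB Require Import structures.
From mathcomp Require Import all_boot all_order all_algebra.
From mathcomp Require Import sesquilinear complex.
From mathcomp Require Import all_classical all_reals all_analysis.
From mathcomp Require Import ring.

Set Implicit Arguments.
Unset Strict Implicit.
Unset Printing Implicit Defensive.

Import Order.TTheory GRing.Theory Num.Theory.
Import numFieldNormedType.Exports.

Local Open Scope classical_set_scope.
Local Open Scope ring_scope.

(* The inner product is linear in its first argument and conjugate-linear in
   its second one. *)
HB.mixin Record CompleteNormedModule_isHilbert (R : realType) E
    of CompleteNormedModule R[i] E := {
  inner : {dot E for Num.conj};
  inner_norm : forall x : E, inner x x = `|x| ^+ 2
}.

#[short(type="hilbertType")]
HB.structure Definition Hilbert (R : realType) :=
  {E of CompleteNormedModule R[i] E & CompleteNormedModule_isHilbert R E}.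

Definition separable (T : topologicalType) : Prop :=
  exists D : set T, countable D /\ dense D.

(* In a normed module over R[i] the norm `|x| is an element of R[i]; this is the
   same number as an element of R. *)
Definition realnorm (R : realType) (E : hilbertType R) (x : E) : R :=
  complex.Re `|x|.

Section Hardy.
Variables (R : realType) (E : hilbertType R).

(* Functions on the disc are represented by total functions on R[i], whose values
   outside the disc are irrelevant. *)
Definition analytic_on_disc (f : R[i] -> E) : Prop :=
  forall z : R[i], `|z| < 1 ->
    derivable (f : (R[i] : numFieldType)^o -> E) z 1.

Definition expi (t : R) : R[i] := (cos t +i* sin t)%C.

Definition circle_mean (p : R) (f : R[i] -> E) (r : R) : \bar R :=
  ((2 * pi)^-1%:E * \int[lebesgue_measure]_(t in `[0%R, (2 * pi)%R])
     (realnorm (f (r%:C * expi t)%C) `^ p)%:E)%E.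

Definition hardy_norm (p : R) (f : R[i] -> E) : \bar R :=
  ereal_sup [set (circle_mean p f r `^ p^-1)%E | r in `]0, 1[].

Definition Hardy (p : R) : set (R[i] -> E) :=
  [set f | analytic_on_disc f /\ (hardy_norm p f < +oo)%E].

End Hardy.

(* The completion is specified up to unitary equivalence: a Hilbert space which
   contains the algebraic tensor square of E (the finite sums of simple tensors)
   as a dense subspace, with the prescribed inner product.  By density there is
   exactly one linear isometry exchanging the factors of simple tensors; it is an
   involution (lemma flipK), hence unitary. *)
Record hilbert_tensor_square (R : realType) (E : hilbertType R) := {
  tensor_space :> hilbertType R;
  tensor : {bilinear E -> E -> tensor_space};
  inner_tensor : forall x1 x2 y1 y2 : E,
    inner (tensor x1 x2) (tensor y1 y2) = 2 * inner x1 y1 * inner x2 y2;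
  tensor_dense :
    dense (range (fun s : seq (E * E) => \sum_(p <- s) tensor p.1 p.2));
  flip : {linear tensor_space -> tensor_space};
  inner_flip : forall s t : tensor_space, inner (flip s) (flip t) = inner s t;
  flip_tensor : forall x y : E, flip (tensor x y) = tensor y x
}.
Arguments tensor {R E h}.
Arguments flip {R E h}.


Section Wedge2.
Variables (R : realType) (E : hilbertType R) (T : hilbert_tensor_square E).

Definition antisymmetric : {pred T} := [pred t : T | flip t == - t].

Fact antisymmetric_submod : submod_closed antisymmetric.
Proof.
split=> [|a s t]; rewrite !inE ?linear0 ?oppr0// => /eqP fs /eqP ft.
by rewrite linearP fs ft scalerN opprD.
Qed.
HB.instance Definition _ :=
  GRing.isSubmodClosed.Build R[i] T antisymmetric antisymmetric_submod.

Record wedge2 := Wedge2 {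
  wedge2_val :> T;
  wedge2_valP : wedge2_val \in antisymmetric
}.
HB.instance Definition _ := [isSub of wedge2 for wedge2_val].
HB.instance Definition _ := [Choice of wedge2 by <:].
HB.instance Definition _ := [SubChoice_isSubLmodule of wedge2 by <:].

Let wnorm (w : wedge2) : R[i] := `|\val w|.

Fact wnormD v w : wnorm (v + w) <= wnorm v + wnorm w.
Proof. exact: ler_normD. Qed.
Fact wnormZ (a : R[i]) w : wnorm (a *: w) = `|a| * wnorm w.
Proof. exact: normrZ. Qed.
Fact wnorm_eq0 w : wnorm w = 0 -> w = 0.
Proof. by move/normr0_eq0 => w0; apply: val_inj. Qed.

HB.instance Definition _ :=
  Lmodule_isNormed.Build R[i] wedge2 wnormD wnormZ wnorm_eq0.

Fact flip_norm (t : T) : `|flip t| = `|t|.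
Proof.
by apply/eqP; rewrite -(@eqrXn2 _ 2)// -!inner_norm inner_flip.
Qed.

Fact wedge2_complete (F : set_system wedge2) :
  ProperFilter F -> cauchy F -> cvg F.
Proof.
move=> FF Fc.
pose G := (\val : wedge2 -> T) @ F.
have Gc : cauchy G.
  apply/cauchy_ballP => e e0.
  move/cauchy_ballP : Fc => /(_ e e0) Fe.
  near_simpl.
  apply: filterS Fe => -[v w] /=.
  by rewrite -!ball_normE.
have Gp : ProperFilter G by exact: fmap_proper_filter.
have /cvg_ex[t Gt] := @cauchy_cvg T G Gp Gc.
have tA : t \in antisymmetric.
  rewrite inE -subr_eq0 opprK -normr_eq0 eq_le normr_ge0 andbT.
  apply/ler_addgt0Pr => e e0; rewrite add0r.
  have e2 : 0 < e / 2 by rewrite divr_gt0.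
  move/cvgrPdist_lt : Gt => /(_ _ e2) /filter_ex[w /=] tw.
  have -> : flip t + t = flip (t - val w) + (t - val w).
    have /eqP fw := wedge2_valP w.
    by rewrite linearB /= fw opprK addrACA subrr addr0.
  rewrite (le_trans (ler_normD _ _))// flip_norm [leRHS]splitr.
  by rewrite lerD// ltW.
apply/cvg_ex; exists (Wedge2 tA).
apply/cvgrPdist_lt => e e0.
by move/cvgrPdist_lt : Gt => /(_ e e0).
Qed.
HB.instance Definition _ := Uniform_isComplete.Build wedge2 wedge2_complete.

Let winner (v w : wedge2) : R[i] := inner (\val v) (\val w).

Fact winner_bilinear : bilinear_for *%R (Num.conj \; *%R) winner.
Proof.
split=> [w a u v|w a u v]; rewrite /winner [\val (_ *: _ + _)]linearP.
  by rewrite linearPl.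
by rewrite linearPr.
Qed.
HB.instance Definition _ := bilinear_isBilinear.Build R[i] wedge2 wedge2 R[i]
  *%R (Num.conj \; *%R) winner winner_bilinear.

Fact winner_herm u v : winner u v = (-1) ^+ false * (winner v u)^*.
Proof. by rewrite /winner hermC. Qed.
HB.instance Definition _ := isHermitianSesquilinear.Build R[i] wedge2 false
  Num.conj winner winner_herm.

Fact winner_gt0 u : u != 0 -> 0 < winner u u.
Proof. by move=> u0; rewrite /winner inner_norm exprn_gt0// normr_gt0. Qed.
HB.instance Definition _ := isDotProduct.Build R[i] wedge2 winner winner_gt0.

Fact winner_norm u : winner u u = `|u| ^+ 2.
Proof. exact: inner_norm. Qed.

HB.instance Definition _ :=
  CompleteNormedModule_isHilbert.Build R wedge2 winner_norm.

(* The orthogonal projection of tensor x y onto wedge2: the only element of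
   wedge2 whose difference with tensor x y is orthogonal to wedge2. *)
Definition wedge (x y : E) : wedge2 :=
  xget 0 [set p : wedge2 |
    forall w : wedge2, inner (tensor x y - \val p) (\val w) = 0].

Lemma flipK (t : T) : flip (flip t) = t.
Proof.
apply/eqP; rewrite -subr_eq0 -normr_eq0 eq_le normr_ge0 andbT.
apply/ler_addgt0Pr => e e0; rewrite add0r.
have e2 : 0 < e / 2 by rewrite divr_gt0.
have ne : ball t (e / 2) !=set0 by exists t; exact: ballxx.
have bo : open (ball t (e / 2)) by exact: ball_open.
have [u [/= te [s _ us]]] := @tensor_dense _ _ T _ ne bo.
have fu : flip (flip u) = u.
  rewrite -us !linear_sum; apply: eq_bigr => p _.
  by rewrite !flip_tensor.
have -> : flip (flip t) - t = flip (flip (t - u)) - (t - u).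
  rewrite [flip (t - u)]linearB [flip (_ - _)]linearB /= fu.
  by rewrite [in RHS]opprD opprK addrACA addNr addr0.
rewrite (le_trans (ler_normB _ _))// !flip_norm [leRHS]splitr.
by move: te; rewrite -ball_normE /= => te; rewrite lerD// ltW.
Qed.

Lemma wedge_val (x y : E) :
  \val (wedge x y) = 2^-1 *: (tensor x y - tensor y x).
Proof.
have pA : 2^-1 *: (tensor x y - tensor y x) \in antisymmetric.
  by rewrite inE linearZ linearB /= !flip_tensor -scalerN opprB.
pose p := Wedge2 pA.
have pv : \val p = 2^-1 *: (tensor x y - tensor y x) by [].
have pP (w : wedge2) : inner (tensor x y - \val p) (\val w) = 0.
  set s := tensor x y - _.
  have sE : s = 2^-1 *: (tensor x y + tensor y x).
    rewrite /s pv.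
    have {1}-> : tensor x y = 2^-1 *: (tensor x y + tensor x y) :> T.
      rewrite -[X in _ *: X]mulr2n -[X in _ *: X]scaler_nat.
      by rewrite scalerA mulVf ?scale1r ?pnatr_eq0.
    by rewrite -scalerBr opprB addrACA subrr addr0.
  have fs : flip s = s.
    by rewrite sE linearZ linearD /= !flip_tensor [in LHS]addrC.
  have /eqP fw := wedge2_valP w.
  have : inner s (\val w) = - inner s (\val w).
    by rewrite -[LHS]inner_flip fs fw linearNr.
  by move/eqP; rewrite -addr_eq0 -mulr2n mulrn_eq0 /= => /eqP.
rewrite /wedge; case: xgetP => [q _ /= qP|/(_ p)]; last by case.
suff -> : q = p by [].
apply/eqP; rewrite -subr_eq0 -normr_eq0 -sqrf_eq0 -inner_norm; apply/eqP.
change (inner (\val q - \val p) (\val (q - p)) = 0).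
have -> : \val q - \val p = tensor x y - \val p - (tensor x y - \val q).
  by rewrite opprB [RHS]addrC addrA subrK.
rewrite linearBl; apply/eqP; rewrite subr_eq0; apply/eqP.
exact: etrans (pP (q - p)) (esym (qP (q - p))).
Qed.

Lemma inner_wedge (x1 x2 y1 y2 : E) :
  inner (wedge x1 x2) (wedge y1 y2) =
  inner x1 y1 * inner x2 y2 - inner x1 y2 * inner x2 y1.
Proof.
change (inner (\val (wedge x1 x2)) (\val (wedge y1 y2)) =
  inner x1 y1 * inner x2 y2 - inner x1 y2 * inner x2 y1).
rewrite !wedge_val linearZl_LR linearZr_LR /= !(linearBl, linearBr) /=.
rewrite !inner_tensor fmorphV /= conjC_nat.
by field.
Qed.

End Wedge2.

Definition pointwise_wedge (R : realType) (E : hilbertType R)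
    (T : hilbert_tensor_square E) (x y : R[i] -> E) : R[i] -> wedge2 T :=
  fun z => wedge T (x z) (y z).

(* Main.v *)
Require Import Defs.
From HB Require Import structures.
From mathcomp Require Import all_boot all_order all_algebra.
From mathcomp Require Import sesquilinear complex.
From mathcomp Require Import all_classical all_reals all_analysis.
From mathcomp Require Import measurable_realfun.
From mathcomp Require Import lra.

Import Order.TTheory GRing.Theory Num.Theory.
Import numFieldNormedType.Exports.

Local Open Scope classical_set_scope.
Local Open Scope ring_scope.

(** The reason is Lagrange's identity
    |u ^ v|^2 = |u|^2 |v|^2 - |<u, v>|^2 in the exterior square, which is the
    diagonal case of the determinant formula [inner_wedge].  It makes the wedge
    product a bilinear map of norm at most 1 ([norm_wedge_le]), and both halves
    of the claim follow from that.

    Analyticity: a bounded bilinear map is continuous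
    ([bilinear_bounded_continuous]), hence differentiable, so that composing it
    with two complex-differentiable functions gives a complex-differentiable
    function ([derivable_bilinear]).

    Growth: pointwise |x ^ y| <= |x| |y| <= |x|^2 + |y|^2, and integrating over
    the circle of radius r bounds the mean of |x ^ y| by the sum of the
    quadratic means of |x| and |y| ([circle_mean_wedge_le]).  These are bounded
    uniformly in r by the squares of the H^2 norms of x and y.  Using
    a b <= a^2 + b^2 in place of the Cauchy-Schwarz inequality for integrals
    loses the sharp constant, but only finiteness is at stake.  Additivity of
    the integral needs measurable integrands: they are continuous, because the
    functions are complex-differentiable along the circle. *)

(** * Bounded bilinear maps *)

(** B u v - B u' v' = B (u - u') v' + B u (v - v'), where v' stays bounded while
    the two differences are small. *)
Lemma bilinear_bounded_continuous (K : numFieldType) (U V W : normedModType K)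
    (B : {bilinear U -> V -> W}) (k : K) :
  0 < k -> (forall u v, `|B u v| <= k * `|u| * `|v|) ->
  continuous (fun p : U * V => B p.1 p.2).
Proof.
move=> k0 Ble [u v] /=; apply/cvgrPdist_lt => e e0.
(* c bounds both |u| and the norm of every v' at distance at most 1 from v. *)
pose c := `|u| + `|v| + 1.
have c0 : 0 < c by rewrite ltr_wpDl// addr_ge0.
have d0 : 0 < e / 2 / c / k by rewrite !divr_gt0.
have Fu : fst p @[p --> (u, v)] --> u by exact: cvg_fst.
have Fv : snd p @[p --> (u, v)] --> v by exact: cvg_snd.
near=> p.
have pu : k * `|u - p.1| < e / 2 / c.
  rewrite mulrC -ltr_pdivlMr//.
  by near: p; move/cvgrPdist_lt : Fu; exact.
have pv : k * `|v - p.2| < e / 2 / c.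
  rewrite mulrC -ltr_pdivlMr//.
  by near: p; move/cvgrPdist_lt : Fv; exact.
have pv1 : `|v - p.2| < 1.
  by near: p; move/cvgrPdist_lt : Fv; exact.
have p2c : `|p.2| <= c.
  have -> : p.2 = v - (v - p.2) by rewrite subKr.
  rewrite (le_trans (ler_normB _ _))// /c -addrA.
  by rewrite ler_wpDl// lerD// ltW.
have uc : `|u| <= c by rewrite /c -addrA ler_wpDr// addr_ge0.
have -> : B u v - B p.1 p.2 = B (u - p.1) p.2 + B u (v - p.2).
  by rewrite linearBl linearBr [RHS]addrC addrA subrK.
rewrite (le_lt_trans (ler_normD _ _))// [ltRHS]splitr.
rewrite ltrD// (le_lt_trans (Ble _ _))//.
  rewrite (le_lt_trans (ler_wpM2l _ p2c)) ?mulr_ge0 ?(ltW k0)//.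
  by rewrite -ltr_pdivlMr.
rewrite mulrAC (le_lt_trans (ler_wpM2l _ uc)) ?mulr_ge0 ?(ltW k0)//.
by rewrite -ltr_pdivlMr.
Unshelve. all: by end_near. Qed.

Lemma derivable_bilinear (K : numFieldType) (U V W : normedModType K)
    (B : {bilinear U -> V -> W}) (f : K^o -> U) (g : K^o -> V) (z : K^o) :
  continuous (fun p : U * V => B p.1 p.2) ->
  derivable f z 1 -> derivable g z 1 ->
  derivable (fun w => B (f w) (g w) : W) z 1.
Proof.
move=> Bc /derivable1_diffP df /derivable1_diffP dg.
apply/derivable1_diffP.
apply: (@differentiable_comp _ _ _ _ (fun w => (f w, g w))
  (fun p : U * V => B p.1 p.2)).
  exact: differentiable_pair.
exact: differentiable_bilin.
Qed.

(** * The norm as a real number *)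

Section RealNorm.
Variables (R : realType) (E : hilbertType R).

Lemma realnormE (u : E) : (realnorm u)%:C%C = `|u|.
Proof. by rewrite /realnorm RRe_real. Qed.

Lemma realnorm_ge0 (u : E) : 0 <= realnorm u.
Proof. rewrite -lecR realnormE; exact: normr_ge0. Qed.

Lemma realnorm_dist (u v : E) : `|realnorm u - realnorm v| <= realnorm (u - v).
Proof.
have tri (a b : E) : realnorm a - realnorm b <= realnorm (a - b).
  by rewrite -lecR rmorphB /= !realnormE lerB_dist.
have sym : realnorm (v - u) = realnorm (u - v) by rewrite /realnorm distrC.
by rewrite ler_norml tri andbT lerNl opprB -sym tri.
Qed.

End RealNorm.

(** * The wedge product is a contraction *)

Section Wedge.
Variables (R : realType) (E : hilbertType R) (T : hilbert_tensor_square E).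

Fact wedge_is_bilinear :
  bilinear_for (GRing.Scale.Law.clone _ _ *:%R _)
    (GRing.Scale.Law.clone _ _ *:%R _) (@wedge R E T).
Proof.
split=> [y a u v|x a u v]; apply: val_inj; rewrite [RHS]linearP /= !wedge_val;
  rewrite linearPl linearPr scalerA mulrC -scalerA -scalerDr; congr (_ *: _);
  by rewrite scalerBr addrACA opprD.
Qed.
HB.instance Definition _ := bilinear_isBilinear.Build R[i] E E (wedge2 T)
  _ _ (@wedge R E T) wedge_is_bilinear.

(** The defect |u|^2 |v|^2 - |u ^ v|^2 is |<u, v>|^2, hence nonnegative. *)
Lemma norm_wedge_le (u v : E) : `|wedge T u v| <= `|u| * `|v|.
Proof.
rewrite -(@ler_pXn2r _ 2)// ?nnegrE ?mulr_ge0//.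
rewrite -inner_norm inner_wedge exprMn -!inner_norm lerBlDr lerDl.
have := hermC (@inner R E) v u; rewrite /= expr0 mul1r => ->.
by rewrite mul_conjC_ge0.
Qed.

Lemma wedge_continuous : continuous (fun p : E * E => wedge T p.1 p.2).
Proof.
apply: (bilinear_bounded_continuous _ _ _ _ (@wedge R E T) 1) => // u v.
by rewrite mul1r norm_wedge_le.
Qed.

Lemma analytic_pointwise_wedge (x y : R[i] -> E) :
  analytic_on_disc x -> analytic_on_disc y ->
  analytic_on_disc (pointwise_wedge T x y).
Proof.
move=> xa ya z z1.
apply: (@derivable_bilinear _ _ _ _ (@wedge R E T) x y z).
- exact: wedge_continuous.
- exact: xa.
- exact: ya.
Qed.

End Wedge.

(** * Means over circles *)

Section Circle.
Variables (R : realType) (E : hilbertType R).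

Lemma norm_circle (r t : R) : `|(r%:C * expi t)%C| = `|r|%:C%C.
Proof.
rewrite normrM [`|expi t|]normc_def /= cos2Dsin2 sqrtr1 mulr1.
by rewrite normc_def /= expr0n addr0 sqrtr_sqr.
Qed.

Lemma expi_continuous : continuous (@expi R : R -> (R[i] : numFieldType)^o).
Proof.
move=> t; apply/cvgrPdist_lt => e e0.
(* The radius e is a positive complex number, hence real: the estimate can be
   carried out on the real and imaginary parts with the bound e / 2 in R. *)
have eR : e = (complex.Re e)%:C%C by rewrite RRe_real// gtr0_real.
have e20 : 0 < complex.Re e / 2.
  by rewrite divr_gt0// -ltcR -eR.
near=> s.
have cs : `|cos t - cos s| < complex.Re e / 2.
  by near: s; move/cvgrPdist_lt : (@continuous_cos R t); exact.
have ss : `|sin t - sin s| < complex.Re e / 2.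
  by near: s; move/cvgrPdist_lt : (@continuous_sin R t); exact.
have le (a b : R) : `|(a +i* b)%C| <= (`|a| + `|b|)%:C%C.
  rewrite normc_def lecR /= -[leRHS]ger0_norm ?addr_ge0// -sqrtr_sqr.
  rewrite ler_wsqrtr// sqrrD !real_normK ?num_real// addrAC lerDl.
  by rewrite mulrn_wge0// mulr_ge0.
apply: (le_lt_trans (le _ _)).
by rewrite eR ltcR [ltRHS]splitr ltrD.
Unshelve. all: by end_near. Qed.

Lemma circle_realnorm_continuous (f : R[i] -> E) (r : R) :
  analytic_on_disc f -> `|r| < 1 ->
  continuous (fun t : R => realnorm (f (r%:C * expi t)%C)).
Proof.
move=> fa r1 t.
have fz : {for (r%:C * expi t)%C,
    continuous (f : (R[i] : numFieldType)^o -> E)}.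
  apply/differentiable_continuous/derivable1_diffP/fa.
  by rewrite norm_circle ltcR.
have fc : f (r%:C * expi s)%C @[s --> t] --> f (r%:C * expi t)%C.
  apply: (@continuous_comp _ _ _
    (fun s : R => (r%:C * expi s)%C : (R[i] : numFieldType)^o) f) => //.
  apply: (@cvgM (R[i] : numFieldType)); first exact: cvg_cst.
  exact: expi_continuous.
apply/cvgrPdist_lt => e e0.
have e0' : 0 < e%:C%C by rewrite ltcR.
move/cvgrPdist_lt : fc => /(_ _ e0'); apply: filterS => s /= fs.
by rewrite (le_lt_trans (realnorm_dist _ _ _ _))// -ltcR realnormE.
Qed.

Lemma circle_integrand_measurable (p : R) (f : R[i] -> E) (r : R) (D : set R) :
  analytic_on_disc f -> `|r| < 1 -> measurable D ->
  measurable_fun (D : set (measurableTypeR R))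
    (fun t => (realnorm (f (r%:C * expi t)%C) `^ p)%:E).
Proof.
move=> fa r1 mD; apply/measurable_EFinP.
apply: (@measurableT_comp _ _ _ _ _ _ (@powR R ^~ p)) => //.
apply: (measurable_funS measurableT) => //.
by apply: continuous_measurable_fun; exact: circle_realnorm_continuous.
Qed.

Lemma circle_mean_ge0 (p : R) (f : R[i] -> E) (r : R) :
  (0 <= circle_mean p f r)%E.
Proof.
rewrite mule_ge0 ?lee_fin ?invr_ge0 ?mulr_ge0 ?pi_ge0//.
by apply: integral_ge0 => t _; rewrite lee_fin powR_ge0.
Qed.

(** Raising the bound on the p-th root back to the power p: the root is the
    quantity whose supremum over r is the Hardy norm. *)
Lemma circle_mean_le_hardy_norm (p : R) (f : R[i] -> E) (r : R) :
  0 < p -> 0 < r < 1 -> (circle_mean p f r <= hardy_norm p f `^ p)%E.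
Proof.
move=> p0 r01.
have mh : (circle_mean p f r `^ p^-1 <= hardy_norm p f)%E.
  by apply: ereal_sup_ubound; exists r => //=; rewrite in_itv.
have -> : circle_mean p f r = ((circle_mean p f r `^ p^-1) `^ p)%E.
  by rewrite -poweRrM mulVf ?gt_eqF// poweRe1// circle_mean_ge0.
have h0 := le_trans (poweR_ge0 _ _) mh.
by apply: gt0_ler_poweR mh; rewrite ?(ltW p0)// in_itv/= leey andbT// poweR_ge0.
Qed.

End Circle.

(** * Integrability of the pointwise wedge product *)

(** Integrating |u| |v| <= |u|^2 + |v|^2, for u and v the values of x and y. *)
Lemma circle_mean_wedge_le (R : realType) (E : hilbertType R)
    (T : hilbert_tensor_square E) (x y : R[i] -> E) (r : R) :
  analytic_on_disc x -> analytic_on_disc y -> `|r| < 1 ->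
  (circle_mean 1 (pointwise_wedge T x y) r <=
     circle_mean 2 x r + circle_mean 2 y r)%E.
Proof.
move=> xa ya r1.
have wa := analytic_pointwise_wedge _ _ T _ _ xa ya.
rewrite /circle_mean -ge0_muleDr; last first.
- by apply: integral_ge0 => t _; rewrite lee_fin powR_ge0.
- by apply: integral_ge0 => t _; rewrite lee_fin powR_ge0.
apply: lee_wpmul2l; first by rewrite lee_fin invr_ge0 mulr_ge0// pi_ge0.
rewrite -ge0_integralD//=; do ?[exact: circle_integrand_measurable];
  do ?[by move=> t _; rewrite lee_fin powR_ge0].
apply: ge0_le_integral => //=; do ?[exact: circle_integrand_measurable];
  do ?[by move=> t _; rewrite ?adde_ge0// lee_fin powR_ge0].
- by apply: emeasurable_funD; exact: circle_integrand_measurable.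
move=> t _; rewrite -EFinD lee_fin powRr1 ?realnorm_ge0//.
rewrite !powR_mulrn ?realnorm_ge0//.
set u := x _; set v := y _.
have : realnorm (wedge T u v) <= realnorm u * realnorm v.
  by rewrite -lecR rmorphM /= !realnormE norm_wedge_le.
move/le_trans; apply.
have := sqr_ge0 (realnorm u - realnorm v).
have := realnorm_ge0 _ _ u; have := realnorm_ge0 _ _ v.
by nra.
Qed.

Theorem proposition3p7 (R : realType) (E : hilbertType R)
    (T : hilbert_tensor_square E) (x y : R[i] -> E) :
  separable E -> Hardy 2 x -> Hardy 2 y -> Hardy 1 (pointwise_wedge T x y).
Proof.
move=> _ [xa xn] [ya yn].
have wa := analytic_pointwise_wedge _ _ T _ _ xa ya.
split=> //.
apply: (@le_lt_trans _ _ (hardy_norm 2 x `^ 2 + hardy_norm 2 y `^ 2)%E).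
  apply: ge_ereal_sup => _ [r /= r01 <-].
  move: r01; rewrite in_itv/= => r01.
  rewrite invr1 poweRe1 ?circle_mean_ge0//.
  apply: (le_trans (circle_mean_wedge_le _ _ _ _ _ r xa ya _)).
    by case/andP: r01 => r0 r1; rewrite gtr0_norm.
  by apply: leeD; apply: circle_mean_le_hardy_norm.
by rewrite lte_add_pinfty// poweR_lty.
Qed.
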